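(* Let $p\in[1,\infty]$, let $E$ be a locally convex space, and let $L$ be an $\infty$-quasibarrelled Grothendieck locally convex space such that for every neighborhood $U$ of zero in $L$ the polar $U^\circ\subseteq L'$ is selectively sequentially pseudocompact in the weak$^\ast$ topology. Then for an operator (continuous linear map) $T:E\to L$ the following assertions are equivalent: (i) $T$ is weakly $p$-convergent; (ii) $T$ is weak$^\ast$ $p$-convergent; (iii) $T$ is $p$-convergent.
   Context: All locally convex spaces are Hausdorff and over the field $\mathbb{F}\in\{\mathbb{R},\mathbb{C}\}$. $E'$ is the topological dual of $E$; $E'_{w^\ast}$ and $E'_\beta$ are $E'$ with the weak$^\ast$ topology $\sigma(E',E)$ and the strong topology $\beta(E',E)$; $A^\circ=\{\chi\in E':|\chi(x)|\le1\ \forall x\in A\}$. A sequence $\{x_n\}$ in $E$ is weakly $p$-summable if for every $\chi\in E'$, $(\langle\chi,x_n\rangle)_n\in\ell_p$ if $p<\infty$, and $(\langle\chi,x_n\rangle)_n\in c_0$ if $p=\infty$. A linear map $T:E\to L$ is: $p$-convergent if it sends weakly $p$-summable sequences of $E$ to null sequences of $L$; weakly $p$-convergent if $\lim_n\langle\eta_n,T(x_n)\rangle=0$ for every weakly null sequence $\{\eta_n\}$ in $L'_\beta$ and every weakly $p$-summable sequence $\{x_n\}$ in $E$; weak$^\ast$ $p$-convergent if the same limit holds for every weak$^\ast$ null sequence $\{\eta_n\}$ in $L'$ and every weakly $p$-summable $\{x_n\}$ in $E$. A locally convex space $L$ is $\infty$-quasibarrelled if every weakly null sequence in the locally convex space $L'_\beta$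 is equicontinuous; it is Grothendieck if the identity map $L'_{w^\ast}\to(L'_\beta)_w$ is sequentially continuous, where $(L'_\beta)_w$ is $L'_\beta$ with its weak topology. A topological space $X$ is selectively sequentially pseudocompact if for every sequence $\{U_n\}$ of non-empty open subsets of $X$ there is $(x_n)\in\prod_nU_n$ containing a subsequence that converges in $X$. *)

(* Defs.v *)
From HB Require Import structures.
From mathcomp Require Import all_boot all_order all_algebra.
From mathcomp Require Import all_classical all_reals all_analysis.
From mathcomp Require Import complex.

Set Implicit Arguments.
Unset Strict Implicit.
Unset Printing Implicit Defensive.

Import Order.TTheory GRing.Theory Num.Theory.
Import numFieldNormedType.Exports.

Local Open Scope classical_set_scope.
Local Open Scope ring_scope.

Variant scalar_field := RealScalars | ComplexScalars.

Definition scalars (R : realType) (k : scalar_field) : numFieldType :=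
  match k with
  | RealScalars => R : numFieldType
  | ComplexScalars => R[i] : numFieldType
  end.

(* On [R[i]], [`|z|] is an element of [R[i]] with zero imaginary part. *)
Definition absr (R : realType) (k : scalar_field) : scalars R k -> R :=
  match k with
  | RealScalars => fun x : R => `|x|
  | ComplexScalars => fun z : R[i] => complex.Re `|z|
  end.

Section dual.
Context (K : numFieldType) (E : preTopologicalLmodType K).

Definition dual_pred : {pred E -> K^o} :=
  fun f => `[< linear f /\ continuous f >].

Record dual := Dual { dual_fun :> E -> K^o ; _ : dual_fun \in dual_pred }.

HB.instance Definition _ := [isSub for dual_fun].
HB.instance Definition _ := [Choice of dual by <:].

Fact dual_pred_submod_closed : submod_closed dual_pred.
Proof.
split.
  apply/asboolP; split.
    by move=> a x y; rewrite /GRing.zero /= /cst scaler0 addr0.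
  by move=> x; exact: cvg_cst.
move=> a f g /asboolP[lf cf] /asboolP[lg cg]; apply/asboolP; split.
  move=> b x y; rewrite !fctE lf lg !scalerDr !scalerA (mulrC a b).
  by rewrite -!addrA; congr (_ + _); rewrite addrCA.
move=> x; apply: cvgD; last exact: cg.
by apply: cvgZl_tmp; exact: cf.
Qed.

HB.instance Definition _ :=
  GRing.isSubmodClosed.Build K (E -> K^o) dual_pred dual_pred_submod_closed.
HB.instance Definition _ := [SubChoice_isSubLmodule of dual by <:].

End dual.

Section dual_topologies.
Context (K : numFieldType) (E : preTopologicalLmodType K).

Definition von_neumann_bounded (A : set E) : Prop :=
  forall U, nbhs (0 : E) U ->
    exists2 r : K, 0 < r & forall c : K, r <= `|c| -> A `<=` *:%R c @` U.

Definition weak : Type := E.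

HB.instance Definition _ := GRing.Lmodule.on weak.
HB.instance Definition _ := Topological.copy weak
  (@initial_topology E {ptws dual E -> K^o} (fun x chi => chi x)).

Definition weakstar_dual : Type := dual E.

HB.instance Definition _ := GRing.Lmodule.on weakstar_dual.
HB.instance Definition _ := Topological.copy weakstar_dual
  (@initial_topology (dual E) {ptws E -> K^o} (@dual_fun K E)).

(* beta(E', E) is the topology of uniform convergence on the bounded sets. *)
Definition strong_dual : Type := dual E.

HB.instance Definition _ := GRing.Lmodule.on strong_dual.
HB.instance Definition _ := Topological.copy strong_dual
  (@initial_topology (dual E) {family von_neumann_bounded, E -> K^o}
     (@dual_fun K E)).

End dual_topologies.

Section dual_properties.
Context (K : numFieldType) (E : preTopologicalLmodType K).

Definition polar (A : set E) : set (dual E) :=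
  [set chi | forall x, A x -> `|chi x| <= 1].

Definition inf_quasibarrelled : Prop :=
  forall eta : nat -> dual E,
    eta @ \oo --> (0 : weak (strong_dual E)) ->
    equicontinuous [set: nat] (fun n => eta n : E -> K^o).

End dual_properties.

Definition sequentially_continuous (X Y : topologicalType) (f : X -> Y) : Prop :=
  forall (u : nat -> X) (l : X), u @ \oo --> l -> f \o u @ \oo --> f l.

Definition selectively_sequentially_pseudocompact (X : topologicalType) : Prop :=
  forall U : nat -> set X, (forall n, open (U n)) -> (forall n, U n !=set0) ->
    exists x : nat -> X, (forall n, U n (x n)) /\
      exists k : nat -> nat, {homo k : m n / (m < n)%N} /\
        exists l : X, x \o k @ \oo --> l.

Definition Grothendieck (K : numFieldType) (E : preTopologicalLmodType K) : Prop :=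
  @sequentially_continuous (weakstar_dual E) (weak (strong_dual E)) id.

Section p_summable.
Context (R : realType) (k : scalar_field).
Let K := scalars R k.

(* Membership in l_p for finite p, and in c_0 for p = +oo. *)
Definition lp_or_c0 (p : \bar R) (a : nat -> K) : Prop :=
  match p with
  | r%:E => cvgn (series (fun n => absr (a n) `^ r))
  | +oo%E => a @ \oo --> (0 : K^o)
  | -oo%E => False
  end.

Definition weakly_p_summable (p : \bar R) (E : preTopologicalLmodType K)
    (x : nat -> E) : Prop :=
  forall chi : dual E, lp_or_c0 p (fun n => chi (x n)).

Context (p : \bar R) (E L : preTopologicalLmodType K) (T : E -> L).

Definition p_convergent : Prop :=
  forall x : nat -> E, weakly_p_summable p x -> T \o x @ \oo --> (0 : L).

Definition weakly_p_convergent : Prop :=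
  forall (eta : nat -> dual L) (x : nat -> E),
    eta @ \oo --> (0 : weak (strong_dual L)) -> weakly_p_summable p x ->
    eta n (T (x n)) @[n --> \oo] --> (0 : K^o).

Definition weakstar_p_convergent : Prop :=
  forall (eta : nat -> dual L) (x : nat -> E),
    eta @ \oo --> (0 : weakstar_dual L) -> weakly_p_summable p x ->
    eta n (T (x n)) @[n --> \oo] --> (0 : K^o).

End p_summable.

(* Main.v *)
Require Import Defs.
From HB Require Import structures.
From mathcomp Require Import all_boot all_order all_algebra.
From mathcomp Require Import all_classical all_reals all_analysis.
From mathcomp Require Import ring lra complex.

Set Implicit Arguments.
Unset Strict Implicit.
Unset Printing Implicit Defensive.

Import Order.TTheory GRing.Theory Num.Theory.
Import numFieldNormedType.Exports.

Local Open Scope classical_set_scope.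
Local Open Scope ring_scope.

(** The three notions are linked by a cycle of implications.

    From weakly to weak-star: by the Grothendieck property a weak-star null
    sequence of functionals is weakly null in the strong dual.

    From [p]-convergent to weakly [p]-convergent: a weakly null sequence of the
    strong dual is equicontinuous because [L] is quasibarrelled in the required
    sense, and an equicontinuous sequence evaluated along a null sequence is
    null ([equicontinuous_cvg0]).

    From weak-star [p]-convergent to [p]-convergent
    ([weakstar_p_convergent_p_convergent]): suppose that [x] is weakly
    [p]-summable while [T x] is not null.  A subsequence of [T x] then avoids a
    neighborhood [U] of zero, and the Hahn-Banach theorem yields a neighborhood
    [V] of zero whose polar contains, for each term avoiding [U], a functional
    of modulus greater than 1 at that term ([polar_separation]).  Hence the
    weak-star open subsets of the polar of [V] where the evaluation at the
    [n]-th term has modulus greater than 1 are non-empty.  Selective sequential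
    pseudocompactness picks functionals in them, a subsequence of which
    converges weak-star to some [chi].  The differences with [chi] form a
    weak-star null sequence, so their values along [T x] tend to zero by
    hypothesis; the values of [chi] itself along [T x] tend to zero because
    [chi \o T] lies in the dual of [E] and [x] is weakly null.  Adding up
    contradicts the bound from below by 1.

    The separation theorem rests on a proof of the Hahn-Banach theorem by
    minimal sublinear functionals: a minimal sublinear functional is linear
    ([minimal_sublinear_linear]), so Zorn's lemma, applied downwards, replaces
    the usual extension of partial functionals one dimension at a time.  The
    complex case is reduced to the real one by restriction of scalars. *)

(** * Hahn-Banach theorem over the reals *)

Section hahn_banach.
Context (R : realType) (V : lmodType R).
Implicit Types p q : V -> R.

(** Positive homogeneity is encoded as an inequality, a form that passes to
    infima at once; the equality is recovered in [sublinearZ]. *)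
Definition sublinear q :=
  (forall x y, q (x + y) <= q x + q y) /\
  (forall r x, 0 < r -> q (r *: x) <= r * q x).

Lemma sublinearZ q r x : sublinear q -> 0 < r -> q (r *: x) = r * q x.
Proof.
move=> [_ qZ] r0; apply/eqP; rewrite eq_le qZ//= -ler_pdivlMl//.
rewrite -[leLHS](_ : q (r^-1 *: (r *: x)) = _) ?qZ ?invr_gt0//.
by rewrite scalerA mulVf ?gt_eqF// scale1r.
Qed.

Lemma sublinear0 q : sublinear q -> q 0 = 0.
Proof.
by move=> /(@sublinearZ _ 2 0)/(_ (ltr0n _ _)); rewrite scaler0; lra.
Qed.

Lemma sublinear_ge_oppN q x : sublinear q -> - q (- x) <= q x.
Proof.
move=> q_sub; have := q_sub.1 x (- x); rewrite subrr (sublinear0 q_sub).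
by lra.
Qed.

(** The largest sublinear functional below [q] that has the value [q y] at [y]
    and is additive along the ray spanned by [y]; it is strictly smaller than
    [q] for some [y] unless [q] is linear. *)
Definition directional_inf q (y x : V) : R :=
  inf [set q (x + t *: y) - t * q y | t in [set t | 0 <= t]].

Section directional_inf.
Context (q : V -> R) (q_sub : sublinear q) (y : V).

Lemma directional_inf_le t x : 0 <= t ->
  directional_inf q y x <= q (x + t *: y) - t * q y.
Proof.
move=> t0; apply: ge_inf; last by exists t.
exists (- q (- x)) => _ [s/= s0 <-].
move: s0; rewrite le0r => /predU1P[->|s0].
  by rewrite scale0r addr0 mul0r subr0 sublinear_ge_oppN.
rewrite -(sublinearZ _ q_sub s0); have := q_sub.1 (x + s *: y) (- x).
by rewrite addrAC subrr add0r; lra.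
Qed.

Lemma le_directional_inf m x :
  (forall t, 0 <= t -> m <= q (x + t *: y) - t * q y) ->
  m <= directional_inf q y x.
Proof.
move=> mq; apply: lb_le_inf => [|_ [t/= t0 <-]]; last exact: mq.
by exists (q (x + 0 *: y) - 0 * q y), 0 => /=.
Qed.

Lemma directional_inf_sublinear : sublinear (directional_inf q y).
Proof.
split=> [x1 x2|r x r0].
  rewrite -lerBlDl; apply: le_directional_inf => t t0.
  rewrite lerBlDl -lerBlDr; apply: le_directional_inf => s s0.
  rewrite lerBlDr; apply: le_trans (directional_inf_le _ (addr_ge0 s0 t0)) _.
  have := q_sub.1 (x1 + s *: y) (x2 + t *: y).
  by rewrite addrACA -scalerDl; lra.
rewrite -ler_pdivrMl//; apply: le_directional_inf => t t0.
rewrite ler_pdivrMl//.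
apply: le_trans (directional_inf_le _ (mulr_ge0 (ltW r0) t0)) _.
by rewrite -scalerA -scalerDr (sublinearZ _ q_sub r0) mulrBr mulrA.
Qed.

Lemma directional_inf_le_id x : directional_inf q y x <= q x.
Proof.
have := directional_inf_le x (lexx 0).
by rewrite scale0r addr0 mul0r subr0.
Qed.

End directional_inf.

(** By minimality, [q] coincides with each [directional_inf q y], whose value at
    [x] is at most [q (x + y) - q y].  So [q] is superadditive, hence
    additive. *)
Lemma minimal_sublinear_linear q : sublinear q ->
    (forall q', sublinear q' -> (forall x, q' x <= q x) ->
       forall x, q x <= q' x) ->
  linear (q : V -> R^o).
Proof.
move=> q_sub q_min.
have qD x y : q (x + y) = q x + q y.
  apply/eqP; rewrite eq_le q_sub.1/=.
  have := q_min _ (directional_inf_sublinear q_sub y)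
    (directional_inf_le_id q_sub y) x.
  have := directional_inf_le q_sub y x ler01.
  by rewrite scale1r mul1r; lra.
have qN x : q (- x) = - q x.
  by apply/eqP; rewrite -addr_eq0 -qD addNr (sublinear0 q_sub).
move=> a x y; rewrite qD; congr (_ + _).
suff : q (a *: x) = a * q x by [].
have [->|a0] := eqVneq a 0; first by rewrite scale0r mul0r (sublinear0 q_sub).
have [a_gt0|a_le0] := ltP 0 a; first exact: sublinearZ.
rewrite -[a]opprK scaleNr qN sublinearZ ?mulNr// oppr_gt0.
by rewrite lt_neqAle a0.
Qed.

(** The pointwise infimum of a chain is finite since [- p (- x)] bounds every
    member from below, and it is subadditive since two members of a chain can
    both be replaced by the smaller one. *)
Lemma chain_inf_sublinear p (A : set (V -> R)) :
    A !=set0 -> (forall q, A q -> sublinear q /\ (forall x, q x <= p x)) ->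
    total_on A (fun q q' => forall x, q' x <= q x) ->
  exists q, [/\ sublinear q, (forall x, q x <= p x) &
    forall q', A q' -> forall x, q x <= q' x].
Proof.
move=> [q0 Aq0] Ap A_chain; pose m x := inf [set q x | q in A].
have m_le q x : A q -> m x <= q x.
  move=> Aq; apply: ge_inf; last by exists q.
  exists (- p (- x)) => _ [q' /Ap[q'_sub q'p] <-].
  by apply: le_trans (sublinear_ge_oppN x q'_sub); rewrite lerN2.
have le_m c x : (forall q, A q -> c <= q x) -> c <= m x.
  move=> cA; apply: lb_le_inf => [|_ [q Aq <-]]; last exact: cA.
  by exists (q0 x), q0.
exists m; split=> [|x|q' Aq' x]; last exact: m_le.
  split=> [x y|r x r0].
    rewrite -lerBlDl; apply: (le_m) => q Aq; rewrite lerBlDl -lerBlDr.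
    apply: (le_m) => q' Aq'; rewrite lerBlDr.
    have [qq'|q'q] := A_chain _ _ Aq Aq'.
      apply: le_trans (m_le _ _ Aq') _; apply: le_trans ((Ap _ Aq').1.1 _ _) _.
      by rewrite lerD2l.
    apply: le_trans (m_le _ _ Aq) _; apply: le_trans ((Ap _ Aq).1.1 _ _) _.
    by rewrite lerD2r.
  rewrite -ler_pdivrMl//; apply: (le_m) => q Aq; rewrite ler_pdivrMl//.
  exact: le_trans (m_le _ _ Aq) ((Ap _ Aq).1.2 _ _ r0).
exact: le_trans (m_le _ _ Aq0) ((Ap _ Aq0).2 x).
Qed.

Lemma linear_below_sublinear p : sublinear p ->
  exists2 f : V -> R^o, linear f & forall x, f x <= p x.
Proof.
move=> p_sub; pose T := {q : V -> R | sublinear q /\ forall x, q x <= p x}.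
pose ge_fun : rel T := fun f g : T => `[< forall x, sval g x <= sval f x >].
have p_below : sublinear p /\ forall x, p x <= p x by [].
have [||A A_chain|[q [q_sub qp]] q_min] :=
  @ZL_preorder T (exist _ p p_below) ge_fun.
- by move=> q; apply/asboolP.
- move=> q1 q2 q3 /asboolP q21 /asboolP q32; apply/asboolP => x.
  exact: le_trans (q32 x) (q21 x).
- have [A0|/set0P[a Aa]] := eqVneq A set0.
    by exists (exist _ p p_below) => s; rewrite A0.
  have [|q [q'a Aq' <-]|_ _ [q1 Aq1 <-] [q2 Aq2 <-]|q [q_sub qp qA]] :=
    @chain_inf_sublinear p (sval @` A).
  + by exists (sval a), a.
  + by case: q'a {Aq'} => q' [].
  + by have [/asboolP|/asboolP] := A_chain _ _ Aq1 Aq2; [left|right].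
  exists (exist _ q (conj q_sub qp)) => s As; apply/asboolP => x /=.
  by apply: qA; exists s.
exists q => //; apply: minimal_sublinear_linear => // q' q'_sub q'q.
have q'p x : q' x <= p x by exact: le_trans (q'q x) (qp x).
by apply/asboolP/(q_min (exist _ q' (conj q'_sub q'p))); apply/asboolP.
Qed.

(** The value at [- x0] of the directional infimum of [p] along [x0] is at most
    [- p x0], so any linear functional below it is at least [p x0] at [x0]. *)
Lemma hahn_banach_at p x0 : sublinear p ->
  exists f : V -> R^o,
    [/\ linear f, forall x, f x <= p x & f x0 = p x0].
Proof.
move=> p_sub.
have [f lf fp] := linear_below_sublinear (directional_inf_sublinear p_sub x0).
exists f; split=> // [x|].
  exact: le_trans (fp x) (directional_inf_le_id _ _ _).
apply/eqP; rewrite eq_le (le_trans (fp _) (directional_inf_le_id _ _ _))//=.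
have := le_trans (fp (- x0)) (directional_inf_le p_sub x0 (- x0) ler01).
have -> : f (- x0) = - f x0.
  have := lf (-1) x0 0; have := lf (-1) 0 0.
  by rewrite !scaleN1r !addr0 oppr0; move=> ? ->; lra.
by rewrite scale1r mul1r addNr (sublinear0 p_sub); lra.
Qed.

(** The Minkowski functional of [U]. *)
Definition gauge (U : set V) (x : V) : R :=
  inf [set t | 0 < t /\ U (t^-1 *: x)].

Section gauge.
Context (U : set V).
Context (U_convex : forall x y t,
  0 <= t -> t <= 1 -> U x -> U y -> U (t *: x + (1 - t) *: y)).
Context (U_absorbing : forall x, exists2 t, 0 < t & U (t^-1 *: x)).

Lemma gauge_le t x : 0 < t -> U (t^-1 *: x) -> gauge U x <= t.
Proof. by move=> t0 Ux; apply: ge_inf => //; exists 0 => s [/ltW]. Qed.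

Lemma le_gauge m x :
  (forall t, 0 < t -> U (t^-1 *: x) -> m <= t) -> m <= gauge U x.
Proof.
move=> mU; apply: lb_le_inf => [|t [t0]]; last exact: mU.
by have [t t0 Ux] := U_absorbing x; exists t.
Qed.

Lemma gauge_sublinear : sublinear (gauge U).
Proof.
split=> [x y|r x r0].
  rewrite -lerBlDl; apply: le_gauge => t t0 Uy; rewrite lerBlDl -lerBlDr.
  apply: le_gauge => s s0 Ux; rewrite lerBlDr.
  apply: gauge_le; first exact: addr_gt0.
  have st0 : s + t != 0 by rewrite gt_eqF// addr_gt0.
  have -> : (s + t)^-1 *: (x + y) =
      (s / (s + t)) *: (s^-1 *: x) + (1 - s / (s + t)) *: (t^-1 *: y).
    rewrite scalerDr !scalerA; congr (_ *: _ + _ *: _).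
      by field; rewrite st0 gt_eqF.
    by field; rewrite st0 gt_eqF.
  apply: U_convex => //.
    by rewrite divr_ge0 ?addr_ge0// ltW.
  by rewrite ler_pdivrMr ?addr_gt0// mul1r lerDl ltW.
rewrite -ler_pdivrMl//; apply: le_gauge => t t0 Ux; rewrite ler_pdivrMl//.
apply: gauge_le; first exact: mulr_gt0.
by rewrite scalerA invfM mulrAC mulVf ?mul1r// gt_eqF.
Qed.

Lemma gauge_ge1 x : ~ U x -> 1 <= gauge U x.
Proof.
move=> Ux; apply: le_gauge => t t0 Utx; rewrite leNgt; apply/negP => t1.
apply: Ux; have [s _] := U_absorbing 0; rewrite scaler0 => U0.
have := U_convex (ltW t0) (ltW t1) Utx U0.
by rewrite scaler0 addr0 scalerA mulfV ?scale1r// gt_eqF.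
Qed.

Lemma convex_separation x0 : ~ U x0 ->
  exists f : V -> R^o,
    [/\ linear f, forall x, U x -> f x <= 1 & 1 <= f x0].
Proof.
move=> Ux0; have [f [lf f_le fx0]] := hahn_banach_at x0 gauge_sublinear.
exists f; split=> // [x Ux|]; last by rewrite fx0 gauge_ge1.
by rewrite (le_trans (f_le x))// gauge_le// invr1 scale1r.
Qed.

End gauge.

End hahn_banach.

(** * Neighborhoods of zero in a locally convex space *)

Section convex_neighborhoods.
Context (K : numFieldType) (E : tvsType K).
Implicit Types U W : set E.

Lemma nbhs0_absorbing U x : nbhs (0 : E) U ->
  exists2 c : K, 0 < c & U (c^-1 *: x).
Proof.
move=> U0; have := @scale_continuous K E (0, x) U; rewrite /= scale0r.
move=> /(_ U0)[[A B] /= [A0 Bx] ABU].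
have [e /= e0 eA] := A0.
exists (e / 2)^-1; first by rewrite invr_gt0 divr_gt0.
rewrite invrK; apply: (ABU (e / 2, x)); split => /=; last exact: nbhs_singleton.
apply: eA; rewrite /= sub0r normrN gtr0_norm ?divr_gt0//.
by rewrite gtr_pMr// invf_lt1// ltr1n.
Qed.

(** The balanced core of a convex neighborhood [b] of zero, that is the set of
    the [x] with [c *: x] in [b] for all scalars [c] of modulus at most 1, is
    again convex; joint continuity of the scaling at (0, 0) makes it a
    neighborhood. *)
Lemma convex_balanced_nbhs U : nbhs (0 : E) U ->
  exists W, [/\ nbhs (0 : E) W, W `<=` U,
    forall c x, `|c| <= 1 -> W x -> W (c *: x) &
    forall x y t, 0 <= t -> t <= 1 -> W x -> W y -> W (t *: x + (1 - t) *: y)].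
Proof.
move=> U0; have [B B_convex [B_open B_basis]] := @locally_convex K E.
have [b [Bb b0] bU] := B_basis 0 _ U0.
have b_nbhs : nbhs (0 : E) b.
  by apply: open_nbhs_nbhs; split=> //; exact: B_open.
exists [set x | forall c, `|c| <= 1 -> b (c *: x)]; split.
- have := @scale_continuous K E (0, 0) b; rewrite /= scale0r.
  move=> /(_ b_nbhs)[[A N] /= [[e /= e0 eA] N0] ANb].
  have e20 : 0 < e / 2 by rewrite divr_gt0.
  apply: filterS (nbhs0Z (lt0r_neq0 e20) N0) => _ [y Ny <-] c c1.
  rewrite scalerA; apply: (ANb (c * (e / 2), y)); split => //=.
  apply: eA; rewrite /= sub0r normrN normrM (gtr0_norm e20).
  rewrite (@le_lt_trans _ _ (e / 2))//.
    by rewrite ler_piMl// ltW.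
  by rewrite gtr_pMr// invf_lt1// ltr1n.
- by move=> x bx; apply: bU; rewrite -[x]scale1r; apply: bx; rewrite normr1.
- move=> c x c1 bx d d1; rewrite scalerA; apply: bx.
  by rewrite normrM mulr_ile1.
- move=> x y t t0 t1 bx b_y c c1.
  rewrite scalerDr !scalerA ![c * _]mulrC -!scalerA.
  exact: set_mem (B_convex _ (mem_set Bb) _ _ (Itv01 t0 t1)
    (mem_set (bx _ c1)) (mem_set (b_y _ c1))).
Qed.

Lemma linear_locally_bounded_continuous (f : E -> K^o) U :
  linear f -> nbhs (0 : E) U -> (forall x, U x -> `|f x| <= 1) -> continuous f.
Proof.
move=> lf U0 fU x; apply/cvgrPdist_lt => e e0.
have e20 : 0 < e / 2 by rewrite divr_gt0.
have := nbhsT x (nbhs0Z (lt0r_neq0 e20) U0).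
apply: filterS => _ [_ [y Uy <-] <-].
have -> : f (x + (e / 2) *: y) = (e / 2) * f y + f x by rewrite addrC lf.
rewrite opprD addrCA subrr addr0 normrN normrM (gtr0_norm e20).
rewrite (@le_lt_trans _ _ (e / 2))//; last first.
  by rewrite gtr_pMr// invf_lt1// ltr1n.
by rewrite ler_piMr ?fU// ltW.
Qed.

End convex_neighborhoods.

(** * Separation over the complex numbers *)

Definition real_restriction (R : realType) (V : lmodType R[i]) : Type := V.

Section real_restriction.
Context (R : realType) (V : lmodType R[i]).
Local Open Scope complex_scope.

Definition real_scale (a : R) (x : real_restriction V) : real_restriction V :=
  (a%:C : R[i]) *: (x : V).

Fact real_scaleA a b v : real_scale a (real_scale b v) = real_scale (a * b) v.
Proof. by rewrite /real_scale scalerA rmorphM. Qed.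

Fact real_scale1 : left_id 1 real_scale.
Proof. by move=> v; exact: scale1r. Qed.

Fact real_scaleDr : right_distributive real_scale +%R.
Proof. by move=> a u v; exact: scalerDr. Qed.

Fact real_scaleDl v : {morph real_scale^~ v : a b / a + b}.
Proof. by move=> a b; rewrite /real_scale rmorphD scalerDl. Qed.

HB.instance Definition _ := GRing.Zmodule.on (real_restriction V).
HB.instance Definition _ := GRing.Zmodule_isLmodule.Build R (real_restriction V)
  real_scaleA real_scale1 real_scaleDr real_scaleDl.

(** The unique complex-linear functional with real part [f]. *)
Definition complexification (f : real_restriction V -> R^o) (x : V) : R[i]^o :=
  (f x +i* - f ('i%C *: x))%C.

Lemma complexification_linear f : linear f -> linear (complexification f).
Proof.
move=> lf.
have fD u v : f (u + v) = f u + f v.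
  by have := lf 1 u v; rewrite !scale1r.
have f0 : f 0 = 0 by have := fD 0 0; rewrite addr0; lra.
have fZ a u : f (a%:C *: (u : V)) = a * f u.
  by have := lf a u 0; rewrite !addr0 f0 addr0.
move=> [a b] x y; rewrite /complexification.
have abE (u : V) : (a +i* b)%C *: u = a%:C *: u + b%:C *: ('i%C *: u).
  by rewrite scalerA -scalerDl; congr (_ *: _); rewrite [LHS]complexE mulrC.
have iiE (u : V) : 'i%C *: ('i%C *: u) = - u.
  by rewrite scalerA -expr2 sqr_i scaleN1r.
have fN u : f (- u) = - f u.
  by have := fZ (-1) u; rewrite rmorphN1 scaleN1r mulN1r.
rewrite scalerDr !fD !abE scalerDr !fD.
have -> : 'i%C *: (a%:C *: x) = a%:C *: ('i%C *: x) by rewrite !scalerA mulrC.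
have -> : 'i%C *: (b%:C *: ('i%C *: x)) = b%:C *: (- x).
  by rewrite -iiE !scalerA mulrA ['i%C * b%:C]mulrC.
rewrite !fZ fN.
apply/eqP; rewrite eq_complex /=; apply/andP; split; apply/eqP; ring.
Qed.

(** A real functional separating [x0] from [U] is the real part of a complex
    one.  Since [U] is balanced, each [x] in [U] can be rotated inside [U] so
    that the complex value becomes real and non-negative, which turns the bound
    on the real part into a bound on the modulus. *)
Lemma complex_separation (U : set V) x0 :
    (forall x y (t : R), 0 <= t -> t <= 1 -> U x -> U y ->
       U (t%:C *: x + (1 - t)%:C *: y)) ->
    (forall x, exists2 t : R, 0 < t & U (t^-1%:C *: x)) ->
    (forall (c : R[i]) x, `|c| <= 1 -> U x -> U (c *: x)) -> ~ U x0 ->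
  exists g : V -> R[i]^o,
    [/\ linear g, forall x, U x -> `|g x| <= 1 & 1 <= `|g x0|].
Proof.
move=> U_convex U_absorbing U_balanced Ux0.
have [f [lf fU fx0]] :=
  @convex_separation R (real_restriction V) U U_convex U_absorbing x0 Ux0.
have lg := complexification_linear lf.
exists (complexification f); split=> // [x Ux|].
  set z := complexification f x.
  have [->|z0] := eqVneq z 0; first by rewrite normr0.
  have nz0 : `|z| != 0 by rewrite normr_eq0.
  (* The phase that rotates z onto its modulus. *)
  pose c : R[i] := `|z| / z.
  have c1 : `|c| <= 1 by rewrite normf_div normr_id divff.
  have gcx : complexification f (c *: x) = `|z|.
    have := lg c x 0; rewrite addr0.
    have -> : complexification f 0 = 0.
      by have := lg (-1) 0 0; rewrite scaleN1r oppr0 addr0 scaleN1r addNr.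
    by rewrite addr0 => ->; rewrite -[LHS]/(c * z) /c divfK.
  have := fU _ (U_balanced _ _ c1 Ux).
  have -> : f (c *: x) = complex.Re (complexification f (c *: x)) by [].
  by rewrite gcx -lecR RRe_real// normr_real.
rewrite (le_trans _ (normc_ge_Re _))// -[1]/(1%:C) lecR.
exact: le_trans fx0 (ler_norm _).
Qed.

End real_restriction.

(** * Functionals and the weak-star topology *)

Lemma increasing_cvgn (u : nat -> nat) :
  {homo u : m n / (m < n)%N} -> u @ \oo --> \oo.
Proof.
move=> u_incr; have le_u n : (n <= u n)%N.
  by elim: n => // n IH; exact: leq_ltn_trans IH (u_incr _ _ (ltnSn n)).
by apply/cvgnyPge => N; exists N => // n /= Nn; exact: leq_trans Nn (le_u n).
Qed.

Section dual_elements.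
Context (K : numFieldType) (E : preTopologicalLmodType K).

Lemma dual_linear (chi : dual E) : linear chi.
Proof. by case: chi => f /= /asboolP[]. Qed.

Lemma dual_continuous (chi : dual E) : continuous chi.
Proof. by case: chi => f /= /asboolP[]. Qed.

Lemma dual0 (chi : dual E) : chi 0 = 0.
Proof.
have := dual_linear chi (-1) 0 0.
by rewrite scaleN1r oppr0 addr0 scaleN1r addNr.
Qed.

Definition mk_dual (f : E -> K^o) (lf : linear f) (cf : continuous f) :
    dual E :=
  Dual (asboolT (conj lf cf) : f \in @dual_pred K E).

Lemma weakstar_cvgP (eta : nat -> weakstar_dual E) (chi : weakstar_dual E) :
  eta @ \oo --> chi <->
  forall x, (eta n : dual E) x @[n --> \oo] --> (chi : dual E) x.
Proof.
split=> [eta_chi|eta_chi].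
  have : (@dual_fun K E \o eta) @ \oo --> (dual_fun chi : {ptws E -> K^o}).
    apply: cvg_comp eta_chi _.
    exact: (@initial_continuous (dual E) {ptws E -> K^o} (@dual_fun K E) chi).
  by move=> /pointwise_cvgP.
have : (@dual_fun K E \o eta) @ \oo --> (dual_fun chi : {ptws E -> K^o}).
  exact/pointwise_cvgP.
move=> h A [_ [[B Bop <-] Bchi sBA]].
have nB : @nbhs _ {ptws E -> K^o} (dual_fun chi) B.
  exact: open_nbhs_nbhs (conj Bop Bchi).
have := h _ nB; rewrite /= !nbhs_simpl.
exact: (@filterS nat \oo _ _ _ (fun n => sBA (eta n))).
Qed.

Lemma weakstar_eval_continuous x :
  continuous (fun chi : weakstar_dual E => (chi : dual E) x : K^o).
Proof.
move=> chi.
apply: (@continuous_comp (weakstar_dual E) {ptws E -> K^o} K^o (@dual_fun K E)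
  (fun f => f x)).
  exact: (@initial_continuous (dual E) {ptws E -> K^o} (@dual_fun K E) chi).
exact: (@proj_continuous E (fun=> K^o) x).
Qed.

End dual_elements.

(** * Scalar sequences in l_p and c_0 *)

Section scalars.
Context (R : realType) (k : scalar_field).
Local Notation K := (scalars R k).

(** Over [R[i]] the order is partial, but a positive element is a real number,
    so that convergence in the scalar field can be tested on the real-valued
    modulus [absr]. *)
Lemma absr_lt (eps : K) : 0 < eps ->
  exists2 e : R, 0 < e & forall z : K, absr z < e -> `|z| < eps.
Proof.
case: k eps => /= eps eps0; first by exists eps.
exists (complex.Re eps); first by move: eps0; rewrite ltcE /= => /andP[].
have epsE := RRe_real (gtr0_real eps0).
suff h (z : R[i]) : complex.Re `|z| < complex.Re eps -> `|z| < eps by exact: h.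
by rewrite -ltcR epsE RRe_real ?normr_real.
Qed.

Lemma absr_ge0 (z : K) : 0 <= absr z.
Proof.
case: k z => z; first exact: (normr_ge0 (z : R)).
suff h (w : R[i]) : 0 <= complex.Re `|w| by exact: h.
by rewrite -lecR RRe_real ?normr_real// normr_ge0.
Qed.

Lemma lp_or_c0_cvg0 (p : \bar R) (a : nat -> K) : (1 <= p)%E ->
  lp_or_c0 p a -> a @ \oo --> (0 : K^o).
Proof.
case: p => [r|//|//] /=; rewrite lee_fin => r1 /cvg_series_cvg_0 a0.
apply/cvgr0Pnorm_lt => eps /absr_lt[e e0 e_eps].
have er0 : 0 < e `^ r by rewrite powR_gt0.
have /cvgr0Pnorm_lt/(_ _ er0) := a0; apply: filterS => n /= an.
apply: e_eps; rewrite ltNge; apply/negP => ean; move: an.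
rewrite ger0_norm ?powR_ge0// ltNge => /negP; apply.
by apply: ge0_ler_powR; rewrite ?nnegrE ?absr_ge0 ?(ltW e0)// (le_trans _ r1).
Qed.

(** For finite [p] the partial sums along [u] are bounded by the partial sums of
    the whole series taken up to [u n]. *)
Lemma lp_or_c0_subseq (p : \bar R) (a : nat -> K) (u : nat -> nat) :
  {homo u : m n / (m < n)%N} -> lp_or_c0 p a -> lp_or_c0 p (a \o u).
Proof.
move=> u_incr.
case: p => [r||//] /=; last first.
  exact: (cvg_comp u a (increasing_cvgn u_incr)).
move=> a_cvg; set b := fun n => absr (a n) `^ r in a_cvg.
have b0 n : 0 <= b n by exact: powR_ge0.
have sb m n : (m <= n)%N -> series b m <= series b n.
  by move=> mn; exact: nondecreasing_series.
have sub_le n : series (b \o u) n <= series b (u n).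
  elim: n => [|n IH]; first by rewrite /series /= big_geq// sumr_ge0.
  rewrite /series /= big_nat_recr//=.
  apply: le_trans (sb _ _ (u_incr _ _ (ltnSn n))).
  by rewrite /series /= [leRHS]big_nat_recr//= lerD2r.
apply: nondecreasing_is_cvgn.
  by apply: nondecreasing_series => i _ _; exact: b0.
exists (limn (series b)) => _ [n _ <-].
apply: le_trans (sub_le n) _.
exact: nondecreasing_cvgn_le.
Qed.

End scalars.

(** * Separation by elements of a polar *)

Lemma balanced_convex_separation (R : realType) (k : scalar_field)
    (V : lmodType (scalars R k)) (W : set V) (x0 : V) :
    (forall c x, `|c| <= 1 -> W x -> W (c *: x)) ->
    (forall x y t, 0 <= t -> t <= 1 -> W x -> W y ->
       W (t *: x + (1 - t) *: y)) ->
    (forall x, exists2 t, 0 < t & W (t^-1 *: x)) -> ~ W x0 ->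
  exists g : V -> (scalars R k)^o,
    [/\ linear g, forall x, W x -> `|g x| <= 1 & 1 <= `|g x0|].
Proof.
case: k V W x0 => V W x0 W_balanced W_convex W_absorbing Wx0.
  have [g [lg gW gx0]] := @convex_separation R V W W_convex W_absorbing x0 Wx0.
  exists g; split=> // [x Wx|]; last exact: le_trans gx0 (ler_norm _).
  rewrite ler_norml gW// andbT lerNl.
  have -> : - g x = g (- x).
    have := lg (-1) x 0; have := lg (-1) 0 0.
    by rewrite !scaleN1r !addr0 oppr0; lra.
  by apply: gW; rewrite -scaleN1r; apply: W_balanced; rewrite ?normrN1.
apply: complex_separation => // [x y t t0 t1|x].
  rewrite rmorphB rmorph1; apply: W_convex; last by rewrite -[1]/(1%:C)%C lecR.
  by rewrite -[0]/(0%:C)%C lecR.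
have [t t0 Wt] := W_absorbing x.
have tE : ((complex.Re t)%:C)%C = t by rewrite RRe_real// gtr0_real.
exists (complex.Re t); first by rewrite -ltcR tE.
have -> : ((complex.Re t)^-1%:C)%C = t^-1 by rewrite fmorphV /= tE.
exact: Wt.
Qed.

Section separation.
Context (R : realType) (k : scalar_field) (L : tvsType (scalars R k)).

(** The functional that separates [x] from a balanced convex neighborhood [W]
    inside [U] has modulus at least 1 at [x].  The set [V] is [W] shrunk by a
    factor 2, so that the functional can be doubled to make this inequality
    strict while staying in the polar of [V]. *)
Lemma polar_separation (U : set L) : nbhs (0 : L) U ->
  exists2 V : set L, nbhs (0 : L) V &
    forall x, ~ U x -> exists2 chi : dual L, polar V chi & 1 < `|chi x|.
Proof.
move=> /convex_balanced_nbhs[W [W0 WU W_balanced W_convex]].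
have two_neq0 : 2^-1 != 0 :> scalars R k by rewrite invr_eq0 pnatr_eq0.
exists ( *:%R 2^-1 @` W); first exact: nbhs0Z.
move=> x Ux; have {Ux} Wx : ~ W x by move=> /WU.
suff [g [lg gW gx]] : exists g : L -> (scalars R k)^o,
    [/\ linear g, forall x, W x -> `|g x| <= 1 & 1 <= `|g x|].
  pose chi := mk_dual lg (linear_locally_bounded_continuous lg W0 gW).
  exists (2 *: chi).
    move=> _ [y Wy <-].
    have -> : (2 *: chi) (2^-1 *: y) = g y.
      have := dual_linear (2 *: chi) 2^-1 y 0; rewrite !addr0 dual0 addr0 => ->.
      by rewrite -[LHS]/(2^-1 * (2 * g y)) mulrA mulVf ?mul1r// pnatr_eq0.
    exact: (gW).
  rewrite -[X in `|X|]/(2 * g x) normrM normr_nat.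
  by rewrite (@lt_le_trans _ _ 2) ?ltr1n// ler_peMr.
exact: (balanced_convex_separation W_balanced W_convex
  (fun y => nbhs0_absorbing y W0) Wx).
Qed.

End separation.

(** * The implications *)

Section implications.
Context (R : realType) (k : scalar_field) (p : \bar R).
Context (E L : tvsType (scalars R k)) (T : {linear E -> L}).

Lemma equicontinuous_cvg0 (eta : nat -> dual L) (y : nat -> L) :
    equicontinuous [set: nat] (fun n => eta n : L -> (scalars R k)^o) ->
    y @ \oo --> (0 : L) ->
  eta n (y n) @[n --> \oo] --> (0 : (scalars R k)^o).
Proof.
move=> eta_equi y0; apply/cvgr0Pnorm_lt => e e0.
have := eta_equi 0 _ (@entourage_ball _ (scalars R k)^o (PosNum e0)).
move=> /y0[N _ etaN]; exists N => // n /etaN /= /(_ n I).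
by rewrite dual0 /ball /= sub0r normrN.
Qed.

Lemma not_cvg0_subseq (y : nat -> L) : ~ (y @ \oo --> (0 : L)) ->
  exists2 U : set L, nbhs (0 : L) U &
    exists2 u : nat -> nat,
      {homo u : m n / (m < n)%N} & forall n, ~ U (y (u n)).
Proof.
move=> /existsNP[U /not_implyP[U0 yU]]; exists U => //.
have far N : exists n, (N <= n)%N /\ ~ U (y n).
  apply: contrapT => /forallNP near_U; apply: yU; exists N => // n /= Nn.
  by apply: contrapT => Uyn; apply: (near_U n).
have [g g_far] := choice far.
exists (fun n => iter n (g \o succn) (g 0%N)).
  apply: homo_ltn => [n m l|n]; first exact: ltn_trans.
  by rewrite iterS /=; exact: (g_far _).1.
by case=> [|n] /=; exact: (g_far _).2.
Qed.

(** This holds because [chi \o T] belongs to the dual of [E]. *)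
Lemma weakly_p_summable_cvg0 (x : nat -> E) (chi : dual L) : (1 <= p)%E ->
    continuous T -> weakly_p_summable p x ->
  chi (T (x n)) @[n --> \oo] --> (0 : (scalars R k)^o).
Proof.
move=> p1 cT x_sum.
have lin : linear (chi \o T : E -> (scalars R k)^o).
  by move=> a u v; rewrite /= linearP dual_linear.
have cont : continuous (chi \o T : E -> (scalars R k)^o).
  by move=> u; apply: continuous_comp; [exact: cT|exact: dual_continuous].
exact: lp_or_c0_cvg0 p1 (x_sum (mk_dual lin cont)).
Qed.

(** Weak-star [p]-convergence is about null sequences of functionals; a
    convergent one is reduced to this case by subtracting its limit [chi], whose
    own contribution vanishes by [weakly_p_summable_cvg0]. *)
Lemma weakstar_p_convergent_cvg0 (x : nat -> E) (eta : nat -> weakstar_dual L)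
    (chi : weakstar_dual L) : (1 <= p)%E -> continuous T ->
    weakstar_p_convergent p T -> weakly_p_summable p x ->
    eta @ \oo --> chi ->
  (eta n : dual L) (T (x n)) @[n --> \oo] --> (0 : (scalars R k)^o).
Proof.
move=> p1 cT T_conv x_sum /weakstar_cvgP eta_chi.
pose delta n : dual L := (eta n : dual L) - (chi : dual L).
have delta0 : (delta : nat -> weakstar_dual L) @ \oo --> (0 : weakstar_dual L).
  apply/weakstar_cvgP => y.
  have := cvgB (eta_chi y) (cvg_cst ((chi : dual L) y)).
  by rewrite subrr; exact.
have -> : (fun n => (eta n : dual L) (T (x n)) : (scalars R k)^o) =
    (fun n => delta n (T (x n)) + (chi : dual L) (T (x n))).
  by apply/funext => n; rewrite -[delta n _]/(_ - _) subrK.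
rewrite -[0]addr0; apply: cvgD; first exact: T_conv.
exact: weakly_p_summable_cvg0.
Qed.

Lemma weakstar_p_convergent_p_convergent :
    (1 <= p)%E -> continuous T ->
    (forall U : set L, nbhs (0 : L) U ->
       selectively_sequentially_pseudocompact
         (set_type (polar U : set (weakstar_dual L)))) ->
  weakstar_p_convergent p T -> p_convergent p T.
Proof.
move=> p1 cT L_polar T_conv x x_sum; apply: contrapT.
move=> /not_cvg0_subseq[U U0 [u u_incr TxuU]].
have [V V0 V_sep] := polar_separation U0.
pose X := set_type (polar V : set (weakstar_dual L)).
pose O n : set X :=
  [set chi | 1 < `|(set_val chi : dual L) (T (x (u n)))|].
have O_open n : open (O n).
  rewrite openE => chi chi1; rewrite /interior.
  have ev_cont : {for chi, continuous (fun psi : X =>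
      (set_val psi : dual L) (T (x (u n))) : (scalars R k)^o)}.
    apply: (@continuous_comp X (weakstar_dual L) (scalars R k)^o set_val
      (fun eta => (eta : dual L) (T (x (u n))))).
      exact: (@initial_continuous X (weakstar_dual L) set_val chi).
    exact: weakstar_eval_continuous.
  have := chi1; rewrite /O /= -subr_gt0 => gap.
  move/cvgrPdist_lt/(_ _ gap): ev_cont; apply: filterS => psi /= near_chi.
  by have := le_lt_trans (lerB_dist _ _) near_chi; rewrite ltrD2l ltrN2.
have O_neq0 n : O n !=set0.
  have [chi chiV chi1] := V_sep _ (TxuU n).
  by exists (exist _ (chi : weakstar_dual L) (mem_set chiV)).
have [chi [chiO [v [v_incr [l chi_l]]]]] := L_polar V V0 O O_open O_neq0.
have {}chi_l : (set_val \o (chi \o v) : nat -> weakstar_dual L) @ \oo -->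
    (set_val l : weakstar_dual L).
  apply: cvg_comp chi_l _.
  exact: (@initial_continuous X (weakstar_dual L) set_val l).
have uv_incr : {homo u \o v : m n / (m < n)%N}.
  by move=> m n /v_incr /u_incr.
have xuv_sum : weakly_p_summable p (x \o (u \o v)).
  by move=> eta; exact: (lp_or_c0_subseq uv_incr (x_sum eta)).
have := weakstar_p_convergent_cvg0 p1 cT T_conv xuv_sum chi_l.
move=> /cvgr0Pnorm_lt/(_ _ ltr01)[N _ /(_ N (leqnn N))]/=.
by move=> /(lt_trans (chiO (v N))); rewrite ltxx.
Qed.

End implications.

Theorem proposition3p2 (R : realType) (k : scalar_field) (p : \bar R)
    (hp : (1 <= p)%E)
    (E : tvsType (scalars R k)) (hE : hausdorff_space E)
    (L : tvsType (scalars R k)) (hL : hausdorff_space L)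
    (hLq : inf_quasibarrelled L) (hLG : Grothendieck L)
    (hLpolar : forall U : set L, nbhs (0 : L) U ->
       selectively_sequentially_pseudocompact
         (set_type (polar U : set (weakstar_dual L))))
    (T : {linear E -> L}) (hT : continuous T) :
  [<-> weakly_p_convergent p T;
       weakstar_p_convergent p T;
       p_convergent p T].
Proof.
tfae.
- move=> T_weak eta x eta0; apply: T_weak; exact: (hLG eta 0 eta0).
- exact: weakstar_p_convergent_p_convergent.
- move=> T_conv eta x eta0 x_sum.
  exact: (equicontinuous_cvg0 (hLq _ eta0) (T_conv x x_sum)).
Qed.
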